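(* Let $N,m\ge 1$ be integers and consider, for $k=1,\dots,N$, the nonlocal system $\partial_t\rho^k+\partial_xF_k(\rho^k,\omega\ast\boldsymbol\rho)=S_k(\boldsymbol\rho,\omega\ast\boldsymbol\rho)$, $\boldsymbol\rho(0,\cdot)=\boldsymbol\rho_0$. Assume there are $\rho_M>\rho_m\ge 0$ such that for every $k\in\{1,\dots,N\}$: (flux) $F_k(\rho_m,\boldsymbol R)=0$ for all $\boldsymbol R\in\mathbb R^m$ and $F_k$ is Lipschitz on $[\rho_m,\rho_M]^{m+1}$ with Lipschitz constant $L_F$; (source) $S_k(\boldsymbol\rho_m,\boldsymbol R)=0$ for all $\boldsymbol R\in\mathbb R^m$, where $\boldsymbol\rho_m=(\rho_m,\dots,\rho_m)^T$, and $S_k$ is Lipschitz on $[\rho_m,\rho_M]^{N+m}$ with Lipschitz constant $L_S$; (initial data) $\boldsymbol\rho_0\in L^\infty(\mathbb R;[\rho_m,\rho_M)^N)$; (kernels) for $\ell=1,\dots,m$: $\omega^{\ell,k}\in L^1\cap BV(\mathbb R;\mathbb R_+)$, $0\in\operatorname{supp}(\omega^{\ell,k})$ and $\int_{\mathbb R}\omega^{\ell,k}(x)\,dx=1$. Then, under the CFL condition $\lambda L_F\le\frac{\sqrt2-1}{2}$, where $\lambda=\Delta t/\Delta x$, there exist $n^*\in\mathbb N$ and a constant $\mathcal C_4\ge0$ depending only on $\omega$, $F$, $S$, $\rho_M$, $m$ and $N$ such that the approximate solutions of the non-staggered Nessyahu-Tadmor scheme (defined in the context) satisfy $$|\rho_j^{k,n}|\le\max_{k=1,\dots,N}\|\rho_0^k\|_{L^\infty(\mathbb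 R;\mathbb R_+)}\exp(\mathcal C_4t^n)$$ for any $j\in\mathbb Z$, $k\in\{1,\dots,N\}$ and $n\in\{0,\dots,n^*\}$.
   Context: **System.** $\boldsymbol\rho=(\rho^1,\dots,\rho^N)$, $F_k:\mathbb R\times\mathbb R^m\to\mathbb R$, $S_k:\mathbb R^N\times\mathbb R^m\to\mathbb R$. The nonlocal term $\boldsymbol R=\omega\ast\boldsymbol\rho\in\mathbb R^m$ has components $R^\ell(t,x)=\sum_{k=1}^N\int_{\mathbb R}\omega^{\ell,k}(y-x)\rho^k(t,y)\,dy$, $\ell=1,\dots,m$. **Grid.** $\Delta x,\Delta t>0$, $\lambda=\Delta t/\Delta x$, $x_j=j\Delta x$, $x_{j\pm1/2}=(j\pm\frac12)\Delta x$ ($j\in\mathbb Z$), $t^n=n\Delta t$. If $\omega^{\ell,k}$ has compact support, write it $[\eta_1^{\ell,k},\eta_2^{\ell,k}]$ with $\eta_1^{\ell,k}\le0\le\eta_2^{\ell,k}$, $\eta_1^{\ell,k}\ne\eta_2^{\ell,k}$, and assume $N_1^{\ell,k}=|\eta_1^{\ell,k}|/\Delta x$, $N_2^{\ell,k}=\eta_2^{\ell,k}/\Delta x$ are nonnegative integers. If the support is unbounded on a side, the corresponding boundary term in the formulas for $R_j^{\ell,k,n}$ and $R_{t,j}^{\ell,k,n}$ is absent and the sum extends to infinity on that side. **minmod.** $\mathrm{mm}(a,b)$ is the argument of smaller absolute value if $ab>0$, and $0$ if $ab\le0$. **NT scheme.** Initially $\rho_j^{k,0}=\frac1{\Delta x}\int_{x_{j-1/2}}^{x_{j+1/2}}\rho_0^k(x)dx$.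 Given $\boldsymbol\rho_j^n=(\rho_j^{1,n},\dots,\rho_j^{N,n})$: 1. $s_j^{k,n}=\mathrm{mm}\big(\frac{\rho_j^{k,n}-\rho_{j-1}^{k,n}}{\Delta x},\frac{\rho_{j+1}^{k,n}-\rho_j^{k,n}}{\Delta x}\big)$. 2. $R_j^{\ell,n}=\sum_kR_j^{\ell,k,n}$ with (indices $\ell,k$ suppressed on $N_1,N_2,\omega$) $$R_j^{\ell,k,n}=\tfrac{\Delta x}{2}\big(\rho^{k,n}_{j-N_1}+\tfrac{\Delta x}{4}s^{k,n}_{j-N_1}\big)\omega\big(\tfrac{\Delta x}{4}-N_1\Delta x\big)+\Delta x\sum_{l=-N_1}^{N_2-2}\rho^{k,n}_{j+l+1}\,\omega((l+1)\Delta x)+\tfrac{\Delta x}{2}\big(\rho^{k,n}_{j+N_2}-\tfrac{\Delta x}{4}s^{k,n}_{j+N_2}\big)\omega\big(N_2\Delta x-\tfrac{\Delta x}{4}\big).$$ 3. $\sigma_j^k=\mathrm{mm}\Big(\frac{F_k(\rho_j^{k,n},\boldsymbol R_j^n)-F_k(\rho_{j-1}^{k,n},\boldsymbol R_{j-1}^n)}{\Delta x},\frac{F_k(\rho_{j+1}^{k,n},\boldsymbol R_{j+1}^n)-F_k(\rho_j^{k,n},\boldsymbol R_j^n)}{\Delta x}\Big)$. 4. With $Q_j^k=S_k(\boldsymbol\rho_j^n,\boldsymbol R_j^n)-\sigma_j^k$, $$R_{t,j}^{\ell,k,n}=\tfrac{\Delta x}{2}Q^k_{j-N_1}\omega\big(\tfrac{\Delta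 x}{4}-N_1\Delta x\big)+\Delta x\sum_{l=-N_1}^{N_2-2}Q^k_{j+l+1}\,\omega((l+1)\Delta x)+\tfrac{\Delta x}{2}Q^k_{j+N_2}\,\omega\big(N_2\Delta x-\tfrac{\Delta x}{4}\big).$$ 5. Half step: $\rho_j^{k,n+1/2}=\rho_j^{k,n}+\frac{\Delta t}{2}Q_j^k$; $R_j^{\ell,n+1/2}=\sum_k\big(R_j^{\ell,k,n}+\frac{\Delta t}{2}R_{t,j}^{\ell,k,n}\big)$. 6. Staggered values: $$\rho_{j+1/2}^{k,n+1}=\tfrac12(\rho_j^{k,n}+\rho_{j+1}^{k,n})+\tfrac{\Delta x}{8}(s_j^{k,n}-s_{j+1}^{k,n})-\lambda\big[F_k(\rho_{j+1}^{k,n+1/2},\boldsymbol R_{j+1}^{n+1/2})-F_k(\rho_j^{k,n+1/2},\boldsymbol R_j^{n+1/2})\big]+\tfrac{\Delta t}{2}\big[S_k(\boldsymbol\rho_{j+1}^{n+1/2},\boldsymbol R_{j+1}^{n+1/2})+S_k(\boldsymbol\rho_j^{n+1/2},\boldsymbol R_j^{n+1/2})\big].$$ 7. With $s_{j+1/2}^{k,n+1}=\mathrm{mm}\big(\frac{\rho_{j+3/2}^{k,n+1}-\rho_{j+1/2}^{k,n+1}}{\Delta x},\frac{\rho_{j+1/2}^{k,n+1}-\rho_{j-1/2}^{k,n+1}}{\Delta x}\big)$: $\rho_j^{k,n+1}=\frac12(\rho_{j-1/2}^{k,n+1}+\rho_{j+1/2}^{k,n+1})-\frac{\Delta x}{8}(s_{j+1/2}^{k,n+1}-s_{j-1/2}^{k,n+1})$.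 **Meaning of $n^*$.** The index $n^*$ encodes a sufficiently small time horizon: the bound is asserted as long as the approximate solutions remain in the range where the (local) Lipschitz continuity of $F_k$ on $[\rho_m,\rho_M]^{m+1}$ with constant $L_F$ and of $S_k$ on $[\rho_m,\rho_M]^{N+m}$ with constant $L_S$ is valid; $n^*$ is the first index at which this is no longer guaranteed for the next step. *)

(* Defs.v *)
From HB Require Import structures.
From mathcomp Require Import all_boot all_order all_algebra.
From mathcomp Require Import all_classical all_reals all_analysis.
Set Implicit Arguments.
Unset Strict Implicit.
Unset Printing Implicit Defensive.
Import Order.TTheory GRing.Theory Num.Theory.
Import numFieldNormedType.Exports.
Local Open Scope classical_set_scope.
Local Open Scope ring_scope.

(** The kernels are evaluated pointwise by the scheme, so they are honest
    functions (not classes modulo a.e. equality) and their variation over the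
    real line is the pointwise one, [sup_(a <= b) TV(f; [a, b])]. *)
Definition finite_variation (R : realType) (f : R -> R) : Prop :=
  exists V : R, forall a b : R, a <= b -> (total_variation a b f <= V%:E)%E.

Definition supp (R : realType) (f : R -> R) : set R :=
  closure [set x | f x != 0].

Definition kernel_hyp (R : realType) (m N : nat)
    (omega : 'I_m -> 'I_N -> R -> R) : Prop :=
  forall l k,
    [/\ (@lebesgue_measure R).-integrable setT (EFin \o omega l k),
        finite_variation (omega l k),
        (forall x, 0 <= omega l k x),
        supp (omega l k) 0
      & (\int[lebesgue_measure]_x (omega l k x)%:E = 1)%E].

Definition in_cube (R : realType) (a b : R) (n : nat) (v : 'rV[R]_n) : Prop :=
  forall i, a <= v 0 i <= b.

Definition dist1 (R : realType) (n : nat) (u v : 'rV[R]_n) : R :=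
  \sum_i `|u 0 i - v 0 i|.

(** Lipschitz constants are taken for the l^1 distance.  It dominates the
    Euclidean and the sup distances, so a Lipschitz constant for either of
    those is also one in the sense below. *)
Definition flux_hyp (R : realType) (m N : nat)
    (F : 'I_N -> R -> 'rV[R]_m -> R) (rhom rhoM LF : R) : Prop :=
  forall k,
    (forall w, F k rhom w = 0) /\
    (forall r r' w w', rhom <= r <= rhoM -> rhom <= r' <= rhoM ->
      in_cube rhom rhoM w -> in_cube rhom rhoM w' ->
      `|F k r w - F k r' w'| <= LF * (`|r - r'| + dist1 w w')).

Definition source_hyp (R : realType) (m N : nat)
    (Src : 'I_N -> 'rV[R]_N -> 'rV[R]_m -> R) (rhom rhoM LS : R) : Prop :=
  forall k,
    (forall w, Src k (const_mx rhom) w = 0) /\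
    (forall v v' w w', in_cube rhom rhoM v -> in_cube rhom rhoM v' ->
      in_cube rhom rhoM w -> in_cube rhom rhoM w' ->
      `|Src k v w - Src k v' w'| <= LS * (dist1 v v' + dist1 w w')).

Definition initial_hyp (R : realType) (N : nat) (rho0 : 'I_N -> R -> R)
    (rhom rhoM : R) : Prop :=
  forall k, measurable_fun setT (rho0 k) /\
    {ae (@lebesgue_measure R), forall x, rhom <= rho0 k x < rhoM}.

Definition max_Linfty (R : realType) (N : nat) (rho0 : 'I_N -> R -> R)
    : \bar R :=
  \big[Order.max/0%E]_(k < N)
    ('N[(@lebesgue_measure R)]_(+oo)[EFin \o rho0 k])%E.

Definition minmod (R : realType) (a b : R) : R :=
  if 0 < a * b then (if `|a| <= `|b| then a else b) else 0.

(** Series over the integers, as the limit of the symmetric partial sums.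
    For finitely supported [u] these are eventually constant. *)
Definition sumZ (R : realType) (u : int -> R) : R :=
  limn (fun M : nat => \sum_(i < M.*2.+1) u ((i : nat)%:Z - M%:Z)).

(** [n1], [n2] are the numbers of cells covered by the support of [f] to the
    left and to the right of the origin; [None] stands for an unbounded side. *)
Definition support_cells (R : realType) (dx : R) (f : R -> R)
    (n1 n2 : option nat) : Prop :=
  ereal_inf (EFin @` supp f) =
    (if n1 is Some p then (- (p%:R * dx))%:E else -oo%E) /\
  ereal_sup (EFin @` supp f) =
    (if n2 is Some q then (q%:R * dx)%:E else +oo%E).

(** Quadrature of [\int f(y - x_j) g(y) dy].  The interior index is
    [i = l + 1], so [l = - n1, ..., n2 - 2] becomes [- n1 < i < n2]; [gl] and
    [gr] are the values used in the left and right boundary half cells. *)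
Definition nonlocal_quad (R : realType) (dx : R) (f : R -> R)
    (n1 n2 : option nat) (gl g gr : int -> R) (j : int) : R :=
  (if n1 is Some p then
     dx / 2 * gl (j - p%:Z) * f (dx / 4 - p%:R * dx)
   else 0)
  + dx * sumZ (fun i : int =>
      if (if n1 is Some p then - p%:Z < i else true) &&
         (if n2 is Some q then i < q%:Z else true)
      then g (j + i) * f (i%:~R * dx) else 0)
  + (if n2 is Some q then
       dx / 2 * gr (j + q%:Z) * f (q%:R * dx - dx / 4)
     else 0).

Section scheme.
Context {R : realType} {m N : nat}.
Variables (F : 'I_N -> R -> 'rV[R]_m -> R)
          (Src : 'I_N -> 'rV[R]_N -> 'rV[R]_m -> R)
          (omega : 'I_m -> 'I_N -> R -> R)
          (dx dt : R) (N1 N2 : 'I_m -> 'I_N -> option nat).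

(* In this section [rho j] is the vector of the densities in the j-th cell. *)
Implicit Types (rho : int -> 'rV[R]_N) (j : int) (k : 'I_N).

Definition slope rho k j : R :=
  minmod ((rho j 0 k - rho (j - 1) 0 k) / dx)
         ((rho (j + 1) 0 k - rho j 0 k) / dx).

Definition nonlocal_comp rho (l : 'I_m) k j : R :=
  nonlocal_quad dx (omega l k) (N1 l k) (N2 l k)
    (fun i => rho i 0 k + dx / 4 * slope rho k i)
    (fun i => rho i 0 k)
    (fun i => rho i 0 k - dx / 4 * slope rho k i) j.

Definition nonlocal rho j : 'rV[R]_m :=
  \row_l \sum_k nonlocal_comp rho l k j.

Definition flux_slope rho k j : R :=
  let f i := F k (rho i 0 k) (nonlocal rho i) in
  minmod ((f j - f (j - 1)) / dx) ((f (j + 1) - f j) / dx).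

Definition rho_t rho k j : R :=
  Src k (rho j) (nonlocal rho j) - flux_slope rho k j.

Definition nonlocal_t_comp rho (l : 'I_m) k j : R :=
  nonlocal_quad dx (omega l k) (N1 l k) (N2 l k)
    (rho_t rho k) (rho_t rho k) (rho_t rho k) j.

Definition rho_half rho j : 'rV[R]_N :=
  \row_k (rho j 0 k + dt / 2 * rho_t rho k j).

Definition nonlocal_half rho j : 'rV[R]_m :=
  \row_l \sum_k (nonlocal_comp rho l k j + dt / 2 * nonlocal_t_comp rho l k j).

(** [staggered rho j] is the value at [x_(j + 1/2)]. *)
Definition staggered rho j : 'rV[R]_N :=
  \row_k (
    (rho j 0 k + rho (j + 1) 0 k) / 2
    + dx / 8 * (slope rho k j - slope rho k (j + 1))
    - dt / dx * (F k (rho_half rho (j + 1) 0 k) (nonlocal_half rho (j + 1))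
                 - F k (rho_half rho j 0 k) (nonlocal_half rho j))
    + dt / 2 * (Src k (rho_half rho (j + 1)) (nonlocal_half rho (j + 1))
                + Src k (rho_half rho j) (nonlocal_half rho j))).

Definition staggered_slope rho k j : R :=
  minmod ((staggered rho (j + 1) 0 k - staggered rho j 0 k) / dx)
         ((staggered rho j 0 k - staggered rho (j - 1) 0 k) / dx).

Definition nt_step rho j : 'rV[R]_N :=
  \row_k ((staggered rho (j - 1) 0 k + staggered rho j 0 k) / 2
    - dx / 8 * (staggered_slope rho k j - staggered_slope rho k (j - 1))).

Definition cell_average (rho0 : 'I_N -> R -> R) j : 'rV[R]_N :=
  \row_k (dx^-1 *
    \int[lebesgue_measure]_(x in `[(j%:~R - 2^-1) * dx, (j%:~R + 2^-1) * dx])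
      rho0 k x).

Definition nt_solution (rho0 : 'I_N -> R -> R) (n : nat) : int -> 'rV[R]_N :=
  iter n nt_step (cell_average rho0).

(** All the arguments at which one step of the scheme started from [rho]
    evaluates the fluxes and the sources lie in the cubes on which the
    Lipschitz bounds of [flux_hyp] and [source_hyp] hold. *)
Definition step_in_range (rhom rhoM : R) rho : Prop :=
  forall j,
    [/\ in_cube rhom rhoM (rho j), in_cube rhom rhoM (nonlocal rho j),
        in_cube rhom rhoM (rho_half rho j)
      & in_cube rhom rhoM (nonlocal_half rho j)].

End scheme.

(** [nstar] is the first index at which [P] fails; [None] means that it never
    does. *)
Definition first_failure (P : nat -> Prop) (nstar : option nat) : Prop :=
  if nstar is Some n0 then (forall n, (n < n0)%N -> P n) /\ ~ P n0
  else forall n, P n.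

Definition up_to (n : nat) (nstar : option nat) : Prop :=
  if nstar is Some n0 then is_true (n <= n0)%N else True.

(* Main.v *)
(** Let P bound the densities at time t^n.  The fluxes and sources vanish at
    rhom >= 0, so they are O(P); a difference of two neighbouring quadratures
    is O(dx P), by summation by parts and the bounded variation of the kernels.
    In one staggered step the terms proportional to the jump
    |rho_(j+1) - rho_j| carry the factor 1/8 + kappa + kappa^2/2, with
    kappa = lambda LF <= 1/4, which is at most 1/2, so they are absorbed by the
    midpoint.  The remainder is at most P (x + x^2/4) with x = C4 dt; there is
    no restriction on dx or dt beyond the CFL condition, so the quadratic term
    is kept and absorbed by exp x.  The slopes of the second half of the step
    are again dominated by the jump. *)
Require Import Defs.
From HB Require Import structures.
From mathcomp Require Import all_boot all_order all_algebra.
From mathcomp Require Import all_classical all_reals all_analysis.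
From mathcomp Require Import measurable_realfun ess_sup_inf ring lra zify.
Set Implicit Arguments.
Unset Strict Implicit.
Unset Printing Implicit Defensive.
Import Order.TTheory GRing.Theory Num.Theory.
Import numFieldNormedType.Exports.
Local Open Scope classical_set_scope.
Local Open Scope ring_scope.

(** * Riemann sums of an integrable function of bounded variation *)

Lemma integrable_cst_finite (R : realType) (A : set R) (c : R) :
  measurable A -> (lebesgue_measure A < +oo)%E ->
  (@lebesgue_measure R).-integrable A (EFin \o cst c).
Proof.
move=> mA muA; apply: measurable_bounded_integrable => //.
by exists `|c|; split; rewrite ?num_real// => y /ltW cy x _.
Qed.

Section kernel.
Context {R : realType}.
Variables (f : R -> R) (V : R).
Hypothesis fV : forall a b : R, a <= b -> (total_variation a b f <= V%:E)%E.

Lemma total_variation_fin_num (a b : R) :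
  a <= b -> total_variation a b f \is a fin_num.
Proof.
move=> ab; rewrite ge0_fin_numE ?total_variation_ge0//.
by rewrite (le_lt_trans (fV ab))// ltry.
Qed.

(** The variation counted from [a] is a telescoping majorant of the increments of [f], both for
    Riemann sums and for summation by parts. *)
Lemma dist_le_total_variation (a x y : R) : a <= x -> x <= y ->
  `|f y - f x| <= fine (total_variation a y f) - fine (total_variation a x f).
Proof.
move=> ax xy; rewrite (total_variationD f ax xy).
rewrite fineD ?total_variation_fin_num// addrAC subrr add0r.
by rewrite -lee_fin fineK ?total_variation_fin_num// total_variation_ge.
Qed.

Lemma fine_total_variation_le (a b : R) :
  a <= b -> 0 <= fine (total_variation a b f) <= V.
Proof.
move=> ab; rewrite fine_ge0 ?total_variation_ge0//=.
by rewrite -lee_fin fineK ?total_variation_fin_num// fV.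
Qed.

Lemma dist_le_variation (x y : R) : `|f x - f y| <= V.
Proof.
wlog yx : x y / y <= x => [H|].
  by have [/H//|/ltW/H] := leP y x; rewrite distrC.
by rewrite -lee_fin (le_trans (total_variation_ge f yx))// fV.
Qed.

Lemma variation_bound_ge0 : 0 <= V.
Proof. exact: le_trans (dist_le_variation 0 0). Qed.

Lemma le_variation_bound (x : R) : f x <= f 0 + V.
Proof. by have := dist_le_variation x 0; rewrite ler_norml => /andP[]; lra. Qed.

Hypothesis f0 : forall x, 0 <= f x.
Hypothesis fint : (@lebesgue_measure R).-integrable setT (EFin \o f).

(** On each cell [f] is at least its left value minus its variation there, and these defects add up
    to at most [V]. The bound is uniform in [a] and [n], which yields convergence of the quadrature
    series on unbounded supports. *)
Lemma riemann_sum_le (a dx : R) (n : nat) : 0 < dx ->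
  \sum_(i < n) dx * f (a + i%:R * dx) <=
  \int[lebesgue_measure]_x f x + dx * V.
Proof.
move=> dx0; pose x_ (i : nat) := a + i%:R * dx.
have x_ge i : a <= x_ i by rewrite lerDl mulr_ge0// ltW.
have x_le i : x_ i <= x_ i.+1 by rewrite lerD2l ler_wpM2r ?ler_nat// ltW.
have intS (A : set R) : measurable A ->
    (@lebesgue_measure R).-integrable A (EFin \o f).
  by move=> mA; apply: integrableS fint.
(* The induction carries the integral over [[a, x_ n[] and the variation up to [x_ n]; [f >= 0] and
   the bound [V] then enlarge both. *)
suff H : \sum_(i < n) dx * f (x_ i) <=
    \int[lebesgue_measure]_(x in `[a, x_ n[) f x +
    dx * fine (total_variation a (x_ n) f).
  apply: (le_trans H); apply: lerD; last first.
    case/andP: (fine_total_variation_le (x_ge n)) => _.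
    by apply: ler_wpM2l; exact: ltW.
  rewrite /Rintegral fine_le//.
  - exact: integrable_fin_num (intS _ _).
  - exact: integrable_fin_num (intS _ _).
  apply: ge0_subset_integral => //.
    exact: measurable_int fint.
  by move=> x _; rewrite lee_fin.
elim: n => [|n IH].
  rewrite big_ord0 addr_ge0//.
    by apply: Rintegral_ge0.
  case/andP: (fine_total_variation_le (x_ge 0%N)) => TV0 _.
  by rewrite mulr_ge0// ltW.
rewrite big_ord_recr/=.
set D := fine (total_variation a (x_ n.+1) f) -
  fine (total_variation a (x_ n) f).
have cell : dx * (f (x_ n) - D) <=
    \int[lebesgue_measure]_(x in `[x_ n, x_ n.+1[) f x.
  have -> : dx * (f (x_ n) - D) =
      \int[lebesgue_measure]_(x in `[x_ n, x_ n.+1[) (fun=> f (x_ n) - D) x.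
    rewrite Rintegral_cst//= lebesgue_measure_itv/= lte_fin.
    rewrite ltrD2l ltr_pM2r// ltr_nat ltnSn/= mulrC; congr (_ * _).
    by rewrite /x_ -[n.+1]addn1 natrD; ring.
  apply: le_Rintegral => //.
  - apply: integrable_cst_finite => //.
    by rewrite lebesgue_measure_itv/=; case: ifP => _; rewrite ?ltry.
  - exact: intS.
  - move=> x /=; rewrite in_itv/= => /andP[x1 x2].
    have := dist_le_total_variation (x_ge n) x1.
    have := dist_le_total_variation (le_trans (x_ge n) x1) (ltW x2).
    rewrite /D !ler_norml => /andP[? ?] /andP[? ?].
    have := normr_ge0 (f (x_ n.+1) - f x).
    have := dist_le_total_variation (le_trans (x_ge n) x1) (ltW x2).
    lra.
have -> : \int[lebesgue_measure]_(x in `[a, x_ n.+1[) f x =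
    \int[lebesgue_measure]_(x in `[a, x_ n[) f x +
    \int[lebesgue_measure]_(x in `[x_ n, x_ n.+1[) f x.
  rewrite -Rintegral_setU//.
  - congr (Rintegral _ _ _).
    by rewrite -itv_bndbnd_setU// bnd_simp.
  - by rewrite -itv_bndbnd_setU ?bnd_simp//; exact: intS.
  - apply/disj_setPS => x [/=]; rewrite !in_itv/= => /andP[_ u] /andP[w _].
    by move: u; rewrite ltNge w.
rewrite /D in cell; move: cell IH; nra.
Qed.

End kernel.

(** * Cell averages of the initial datum *)

Section initial_datum.
Context {R : realType} {N : nat}.
Variables (rho0 : 'I_N -> R -> R) (rhom rhoM : R).
Hypotheses (rhom_ge0 : 0 <= rhom) (rhomM : rhom < rhoM).
Hypothesis rho0P : initial_hyp rho0 rhom rhoM.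

Let ae_imply (P Q : R -> Prop) : (forall x, P x -> Q x) ->
  {ae (@lebesgue_measure R), forall x, P x} ->
  {ae (@lebesgue_measure R), forall x, Q x}.
Proof. exact: (@filterS _ _ (ae_filter_ringOfSetsType lebesgue_measure)). Qed.

Let Linfty_ess_sup k :
  ('N[(@lebesgue_measure R)]_(+oo)[EFin \o rho0 k] =
   ess_sup (@lebesgue_measure R) (abse \o (EFin \o rho0 k)))%E.
Proof.
rewrite unlock /=.
(* The norm of exponent [+oo] is an essential supremum only when the whole space has positive
   measure; otherwise it is a default value. *)
have -> : lebesgue_measure (setT : set R) = +oo%E.
  by rewrite -set_itvNyy lebesgue_measure_itv.
by rewrite ltry.
Qed.

Lemma max_Linfty_fin_num : max_Linfty rho0 \is a fin_num.
Proof.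
rewrite ge0_fin_numE; last exact: bigmax_ge_id.
apply: (@le_lt_trans _ _ rhoM%:E); last exact: ltry.
apply: bigmax_le => [|k _]; first by rewrite lee_fin (le_trans rhom_ge0) ?ltW.
rewrite Linfty_ess_sup; apply/ess_supP.
have [_] := rho0P k; apply: ae_imply => x /andP[x1 x2] /=.
by rewrite lee_fin ger0_norm; [exact: ltW | exact: le_trans x1].
Qed.

Lemma norm_cell_average_le (dx : R) (j : int) (k : 'I_N) : 0 < dx ->
  `|cell_average dx rho0 j 0 k| <= fine (max_Linfty rho0).
Proof.
move=> dx0; rewrite mxE; set A := (X in \int[_]_(_ in X) _).
have mA : measurable A by exact: measurable_itv.
have muA : lebesgue_measure A = dx%:E.
  rewrite lebesgue_measure_itv/= lte_fin ltr_pM2r// ifT; last by lra.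
  by congr EFin; field.
set K := fine _.
have aeK : {ae (@lebesgue_measure R), forall x, A x -> `|rho0 k x| <= K}.
  have := ess_sup_ge (@lebesgue_measure R) (abse \o (EFin \o rho0 k)).
  apply: ae_imply => x /=; rewrite -Linfty_ess_sup => xK _.
  rewrite -lee_fin fineK ?max_Linfty_fin_num//.
  apply: (le_trans xK).
  exact: (@le_bigmax _ _ _ 0%E
    (fun k => 'N[(@lebesgue_measure R)]_(+oo)[EFin \o rho0 k])%E k).
have K0 : 0 <= K by rewrite fine_ge0//; exact: bigmax_ge_id.
have [mrho _] := rho0P k.
have mrhoA : measurable_fun A (rho0 k) by exact: measurable_funS mrho.
have le_int : (\int[lebesgue_measure]_(x in A) `|(rho0 k x)%:E| <=
    (K * dx)%:E)%E.
  have -> : ((K * dx)%:E = \int[lebesgue_measure]_(x in A) K%:E)%E.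
    by rewrite integral_cst// EFinM; congr (_ * _)%E; exact/esym/muA.
  apply: ae_ge0_le_integral => //.
  - by apply/measurable_EFinP; exact: measurableT_comp.
have intA : (@lebesgue_measure R).-integrable A (EFin \o rho0 k).
  apply/integrableP; split; first exact/measurable_EFinP.
  exact: le_lt_trans le_int (ltry _).
rewrite normrM gtr0_norm ?invr_gt0// mulrC ler_pdivrMr//.
apply: (le_trans (le_normr_Rintegral _ intA)); first exact: mA.
rewrite -lee_fin /Rintegral fineK//.
have := integrable_norm intA; exact: integrable_fin_num.
Qed.

End initial_datum.

(** * Series over the integers and summation by parts *)

Definition symmetric_sum (R : realType) (u : int -> R) (M : nat) : R :=
  \sum_(i < M.*2.+1) u ((i : nat)%:Z - M%:Z).

Section integer_sums.
Context {R : realType}.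
Implicit Types u w : int -> R.

(** Pairing [i] with [- i] gives an ordinary series over the naturals, to which absolute convergence
    applies. *)
Lemma symmetric_sumE u (M : nat) :
  symmetric_sum u M =
  u 0 + \sum_(0 <= i < M) (u i.+1%:Z + u (- i.+1%:Z)).
Proof.
elim: M => [|M IH].
  by rewrite /symmetric_sum big_ord1 big_geq// subr0 addr0.
rewrite big_nat_recr//= addrA -IH /symmetric_sum doubleS.
rewrite big_ord_recl big_ord_recr/=.
rewrite [LHS]addrC [RHS]addrA sub0r; congr (_ + _ + _).
- by apply: eq_bigr => i _; congr u; rewrite /bump /=; lia.
- by congr u; rewrite /bump /=; lia.
Qed.

Lemma is_cvg_symmetric_sum u w (W : R) :
  (forall i, `|u i| <= w i) -> (forall M, symmetric_sum w M <= W) ->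
  cvgn (symmetric_sum u).
Proof.
move=> uw wW.
have -> : symmetric_sum u =
    cst (u 0) \+ series (fun i : nat => u i.+1%:Z + u (- i.+1%:Z)).
  by apply/funext => M; exact: symmetric_sumE.
apply: is_cvgD; first exact: is_cvg_cst.
apply: normed_cvg; apply: nondecreasing_is_cvgn.
  by apply: nondecreasing_series => n _ _; exact: normr_ge0.
exists W => _ [n _ <-] /=; apply: le_trans (wW n).
rewrite symmetric_sumE /series/= -[leLHS]add0r lerD//.
  by rewrite (le_trans _ (uw 0)).
by apply: ler_sum => i _; rewrite (le_trans (ler_normD _ _))// lerD.
Qed.

(** Differences and norms pass through [limn] once both sequences converge; a bound uniform in [M]
    then suffices. *)
Lemma norm_sumZB_le u w (C : R) :
  cvgn (symmetric_sum u) -> cvgn (symmetric_sum w) ->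
  (forall M, `|symmetric_sum u M - symmetric_sum w M| <= C) ->
  `|sumZ u - sumZ w| <= C.
Proof.
move=> cu cw uwC.
have -> : sumZ u - sumZ w = limn (symmetric_sum u - symmetric_sum w).
  by rewrite limB.
have cuw : cvgn (symmetric_sum u - symmetric_sum w) by exact: is_cvgB.
rewrite -lim_norm//; apply: limr_le; first exact: is_cvg_norm.
by apply: nearW => M; exact: uwC.
Qed.

(* Summation by parts: moves the difference from [y] onto [v]. *)
Lemma norm_sum_diff_le (y v D : nat -> R) (G B E : R) (n : nat) :
  (forall i, `|y i| <= G) -> (forall i, `|v i| <= B) ->
  (forall i, (i < n)%N -> `|v i.+1 - v i| <= D i.+1 - D i) ->
  D n - D 0%N <= E ->
  `|\sum_(i < n) (y i.+1 - y i) * v i| <= G * (2 * B + E).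
Proof.
move=> yG vB vD DE.
have G0 : 0 <= G by exact: le_trans (yG 0%N).
(* The boundary terms stay inside the norm, so each induction step adds only
   [y k.+1 * (v k.+1 - v k)]. They are put back at the end, at a cost of [2 * G * B]. *)
have H k : (k <= n)%N ->
    `|\sum_(i < k) (y i.+1 - y i) * v i - y k * v k + y 0%N * v 0%N|
    <= G * (D k - D 0%N).
  elim: k => [_|k IH kn].
    by rewrite big_ord0 sub0r addNr normr0 subrr mulr0.
  rewrite big_ord_recr/=; set S := \sum_(i < k) _ in IH *.
  have -> : S + (y k.+1 - y k) * v k - y k.+1 * v k.+1 + y 0%N * v 0%N =
      (S - y k * v k + y 0%N * v 0%N) - y k.+1 * (v k.+1 - v k) by ring.
  rewrite (le_trans (ler_normB _ _))// normrM.
  have -> : G * (D k.+1 - D 0%N) = G * (D k - D 0%N) + G * (D k.+1 - D k).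
    by ring.
  by rewrite lerD ?IH ?ler_pM ?vD// ltnW.
have /= := H n (leqnn n); set S := \sum_(i < n) _ => HS.
have -> : S = (S - y n * v n + y 0%N * v 0%N) + y n * v n - y 0%N * v 0%N.
  by ring.
have yv i : `|y i * v i| <= G * B by rewrite normrM ler_pM.
rewrite (le_trans (ler_normB _ _))//.
have -> : G * (2 * B + E) = (G * E + G * B) + G * B by ring.
rewrite lerD// (le_trans (ler_normD _ _))// lerD// (le_trans HS)//.
by rewrite ler_wpM2l.
Qed.

End integer_sums.

(** * Differences of neighbouring quadratures *)

Section quadrature.
Context {R : realType}.
Variables (f : R -> R) (V dx G : R) (n1 n2 : option nat).
Hypothesis fV : forall a b : R, a <= b -> (total_variation a b f <= V%:E)%E.
Hypothesis f0 : forall x, 0 <= f x.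
Hypothesis fint : (@lebesgue_measure R).-integrable setT (EFin \o f).
Hypothesis dx0 : 0 < dx.

(** The cut-offs are part of the weight, so the quadratures at [j] and [j + 1] share one weight
    sequence and differ by an index shift of [g]. *)
Let inner_weight (i : int) : R :=
  if (if n1 is Some p then - p%:Z < i else true) &&
     (if n2 is Some q then i < q%:Z else true)
  then f (i%:~R * dx) else 0.

Let inner_weight_bound (i : int) : `|inner_weight i| <= f 0 + V.
Proof.
rewrite /inner_weight; case: ifP => _.
  by rewrite ger0_norm// le_variation_bound.
by rewrite normr0 addr_ge0//; exact: (variation_bound_ge0 fV).
Qed.

(** Domination by [G * f (i%:~R * dx)], whose symmetric sums are, up to the factor [dx], Riemann
    sums started at [- M%:R * dx]. *)
Let is_cvg_inner_sum (g : int -> R) (j : int) : (forall i, `|g i| <= G) ->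
  cvgn (symmetric_sum (fun i => g (j + i) * inner_weight i)).
Proof.
move=> gG; have G0 : 0 <= G by exact: le_trans (gG 0).
apply: (@is_cvg_symmetric_sum _ _ (fun i : int => G * f (i%:~R * dx))
  (G * ((\int[lebesgue_measure]_x f x + dx * V) / dx))) => [i|M].
  rewrite normrM ler_pM// /inner_weight; case: ifP => _; rewrite ?normr0//.
  by rewrite ger0_norm.
rewrite /symmetric_sum -big_distrr/= ler_wpM2l// ler_pdivlMr// mulrC.
rewrite big_distrr/=.
have := riemann_sum_le fV f0 fint (- M%:R * dx) M.*2.+1 dx0.
apply: le_trans; apply: ler_sum => i _; rewrite le_eqVlt; apply/orP; left.
by apply/eqP; congr (_ * f _); rewrite rmorphB/=; ring.
Qed.

(** The bound is free of [M], hence passes to the limit, and free of [1 / dx]. With [B = f 0 + V],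
    the boundary terms cost [2 * B] and the variation of the weights [3 * B]: [V <= B] from [f], and
    [B] from each cut-off. *)
Let norm_inner_sum_diff_le (g : int -> R) (j : int) (M : nat) :
  (forall i, `|g i| <= G) ->
  `|symmetric_sum (fun i => g (j + 1 + i) * inner_weight i) M -
    symmetric_sum (fun i => g (j + i) * inner_weight i) M|
  <= G * (5 * (f 0 + V)).
Proof.
move=> gG; have G0 : 0 <= G by exact: le_trans (gG 0).
have V0 := variation_bound_ge0 fV.
set B := f 0 + V; have B0 : 0 <= B by rewrite addr_ge0.
pose a := - M%:R * dx; pose z (i : nat) : int := i%:Z - M%:Z.
pose x (i : nat) : R := (z i)%:~R * dx.
pose T i := fine (total_variation a (x i) f).
pose l i : bool := if n1 is Some p then - p%:Z < z i else true.
pose r i : bool := if n2 is Some q then z i < q%:Z else true.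
have ll i : l i -> l i.+1.
  by rewrite /l /z; case: n1 => [p|//]; clear; lia.
have rr i : r i.+1 -> r i.
  by rewrite /r /z; case: n2 => [q|//]; clear; lia.
(* The cut-offs are monotone in the index, so they contribute at most [B]
   each to the variation of the weights. *)
pose D i : R := T i + (l i)%:R * B - (r i)%:R * B.
rewrite /symmetric_sum -sumrB.
rewrite (eq_bigr (fun i : 'I_M.*2.+1 => (g (j + z i.+1) - g (j + z i)) *
  inner_weight (z i))); last first.
  move=> i _; rewrite -/(z i) mulrBl; congr (g _ * _ - _).
  by rewrite /z; lia.
have ax i : a <= x i.
  by rewrite /a /x /z rmorphB/= ler_pM2r// -[leLHS]add0r lerD2r ler0n.
have xx i : x i <= x i.+1.
  by rewrite /x /z ler_pM2r// ler_int; lia.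
have -> : 5 * B = 2 * B + 3 * B by ring.
apply: (@norm_sum_diff_le _ (fun i => g (j + z i))
  (fun i => inner_weight (z i)) D) => // [i _|].
  have TD := dist_le_total_variation fV (ax i) (xx i).
  have TD0 := le_trans (normr_ge0 _) TD.
  have fi := le_variation_bound fV (x i).
  have fi1 := le_variation_bound fV (x i.+1).
  rewrite /inner_weight -/(l i) -/(r i) -/(l i.+1) -/(r i.+1).
  rewrite -/(x i) -/(x i.+1).
  rewrite /D; move: (ll i) (rr i) TD TD0 fi fi1 (f0 (x i)) (f0 (x i.+1)).
  rewrite -/B -/(T i) -/(T i.+1).
  case: (l i); case: (l i.+1); case: (r i); case: (r i.+1) => //= lli rri;
    do ?[by have := lli isT|by have := rri isT];
    rewrite ?mul1r ?mul0r ?sub0r ?subr0 ?subrr ?normrN ?normr0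
      => TD TD0 fi fi1 fi0 fi10;
    rewrite ?(ger0_norm fi0) ?(ger0_norm fi10); lra.
have [Tn0 TnV] := andP (fine_total_variation_le fV (ax M.*2.+1)).
have [T00 _] := andP (fine_total_variation_le fV (ax 0%N)).
rewrite /D -/(T 0%N) -/(T _) in Tn0 TnV T00 *.
have f00 := f0 0.
have : 3 * B = f 0 + V + 2 * B by rewrite /B; ring.
have bB (b : bool) : 0 <= b%:R * B <= B.
  by case: b; rewrite ?mul1r ?mul0r lexx B0.
have := bB (l 0%N); have := bB (l M.*2.+1).
have := bB (r 0%N); have := bB (r M.*2.+1); lra.
Qed.

(* Only differences of the quadrature enter the fluxes; they are controlled by
   the variation of [f], whatever the size of its support. *)
Lemma norm_nonlocal_quad_diff_le (gl g gr : int -> R) (j : int) :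
  (forall i, `|gl i| <= G) -> (forall i, `|g i| <= G) ->
  (forall i, `|gr i| <= G) ->
  `|nonlocal_quad dx f n1 n2 gl g gr (j + 1) -
    nonlocal_quad dx f n1 n2 gl g gr j| <= dx * (G * (7 * (f 0 + V))).
Proof.
move=> glG gG grG; have G0 : 0 <= G by exact: le_trans (gG 0).
have V0 := variation_bound_ge0 fV.
rewrite /nonlocal_quad.
have sumE (i0 : int) : sumZ (fun i : int =>
      if (if n1 is Some p then - p%:Z < i else true) &&
         (if n2 is Some q then i < q%:Z else true)
      then g (i0 + i) * f (i%:~R * dx) else 0) =
    sumZ (fun i => g (i0 + i) * inner_weight i).
  congr sumZ; apply/funext => i; rewrite /inner_weight.
  by case: ifP => _; rewrite ?mulr0.
rewrite !sumE.
have inner : `|sumZ (fun i => g (j + 1 + i) * inner_weight i) -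
    sumZ (fun i => g (j + i) * inner_weight i)| <= G * (5 * (f 0 + V)).
  apply: norm_sumZB_le; [exact: is_cvg_inner_sum..|].
  by move=> M; exact: norm_inner_sum_diff_le.
have edge (h : int -> R) (i1 i2 : int) (x : R) : (forall i, `|h i| <= G) ->
    `|dx / 2 * h i1 * f x - dx / 2 * h i2 * f x| <= dx * (G * (f 0 + V)).
  move=> hG; have -> : dx / 2 * h i1 * f x - dx / 2 * h i2 * f x =
    dx * ((h i1 - h i2) / 2 * f x) by field.
  rewrite normrM gtr0_norm// ler_pM2l// normrM ler_pM//.
    rewrite normrM (@ger0_norm _ 2^-1) ?invr_ge0// ler_pdivrMr//.
    by rewrite (le_trans (ler_normB _ _))// mulr_natr mulr2n lerD.
  by rewrite ger0_norm// le_variation_bound.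
have bound_ge0 : 0 <= dx * (G * (f 0 + V)).
  by rewrite !mulr_ge0 ?addr_ge0// ltW.
set Sj1 := sumZ _ in inner *; set Sj := sumZ _ in inner *.
set L1 := (X in X + dx * Sj1 + _); set R1 := (X in _ + dx * Sj1 + X).
set L0 := (X in _ - (X + dx * Sj + _)); set R0 := (X in _ - (_ + dx * Sj + X)).
have HL : `|L1 - L0| <= dx * (G * (f 0 + V)).
  by rewrite /L1 /L0; case: n1 => [p|]; [exact: edge | rewrite subrr normr0].
have HR : `|R1 - R0| <= dx * (G * (f 0 + V)).
  by rewrite /R1 /R0; case: n2 => [q|]; [exact: edge | rewrite subrr normr0].
have -> : L1 + dx * Sj1 + R1 - (L0 + dx * Sj + R0) =
  (L1 - L0) + dx * (Sj1 - Sj) + (R1 - R0) by ring.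
(* The constant is [7 = 1 + 5 + 1]: two boundary half cells around the interior sum. *)
have -> : dx * (G * (7 * (f 0 + V))) = dx * (G * (f 0 + V)) +
  dx * (G * (5 * (f 0 + V))) + dx * (G * (f 0 + V)) by ring.
rewrite (le_trans (ler_normD _ _))// lerD// (le_trans (ler_normD _ _))// lerD//.
by rewrite normrM gtr0_norm// ler_pM2l.
Qed.

End quadrature.

(** * The limiter and perturbed midpoints *)

Section minmod.
Context {R : realType}.
Implicit Types a b c P : R.

(** In a tie of absolute values, the positive product forces [a = b]. *)
Lemma minmodC a b : minmod a b = minmod b a.
Proof.
rewrite /minmod mulrC; case: ifPn => // ab; case: ltgtP => // eqab.
move: ab eqab; have [a0|a0] := leP 0 a; have [b0|b0] := leP 0 b;
  rewrite ?(ger0_norm a0) ?(ger0_norm b0) ?(ltr0_norm a0) ?(ltr0_norm b0); nra.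
Qed.

Lemma minmod_betweenl a b :
  (0 <= minmod a b <= a) || (a <= minmod a b <= 0).
Proof.
rewrite /minmod; case: ifPn => ab; last first.
  by case: (leP 0 a) => ?; rewrite ?lexx//= ltW ?orbT.
case: ifPn => [_|]; first by case: (leP 0 a) => ?; rewrite ?lexx//= ltW.
rewrite -ltNge; have [a0|a0] := leP 0 a; have [b0|b0] := leP 0 b; try nra.
  by rewrite !ger0_norm// => /ltW ->.
by rewrite !ltr0_norm// => ?; apply/orP; right; apply/andP; split; lra.
Qed.

Lemma norm_minmod_lel a b : `|minmod a b| <= `|a|.
Proof.
have /orP[/andP[m0 ma]|/andP[am m0]] := minmod_betweenl a b.
  by rewrite !ger0_norm// (le_trans m0).
by rewrite !ler0_norm ?lerN2// (le_trans am).
Qed.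

(* Two consecutive limited slopes share the argument [b], and both lie
   between [0] and [b]. *)
Lemma norm_minmodB_le a b c : `|minmod a b - minmod b c| <= `|b|.
Proof.
rewrite (minmodC a); move: (minmod_betweenl b a) (minmod_betweenl b c).
move: (minmod b a) (minmod b c) => x y.
have [b0|b0] := leP 0 b => /orP[]/andP[? ?] /orP[]/andP[? ?];
  rewrite ?(ger0_norm b0) ?(ltr0_norm b0) ler_norml; apply/andP; split; lra.
Qed.

(** Since [|a + b| / 2 + |b - a| / 2] is the larger of [|a|] and [|b|], half the jump fits below
    [P], and only [c] enlarges the bound. *)
Lemma norm_midpoint_le a b c P e :
  `|a| <= P -> `|b| <= P -> `|e| <= `|b - a| / 2 + c ->
  `|(a + b) / 2 + e| <= P + c.
Proof.
rewrite !(ler_norml _ P) ler_norml ler_norml => /andP[? ?] /andP[? ?].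
have [ba|ba] := leP 0 (b - a);
  rewrite ?(ger0_norm ba) ?(ltr0_norm ba) => /andP[? ?];
  by apply/andP; split; lra.
Qed.

End minmod.

(** * Distances of vectors and scalar inequalities *)

Lemma dist1_row_sum_le (R : realType) (m N : nat) (u v w : 'I_m -> 'I_N -> R)
    (c : R) :
  (forall l k, `|u l k - v l k| <= c * w l k) ->
  dist1 (\row_l \sum_k u l k) (\row_l \sum_k v l k) <=
  c * \sum_l \sum_k w l k.
Proof.
move=> uvw; rewrite /dist1 big_distrr/=; apply: ler_sum => l _.
rewrite !mxE -sumrB big_distrr/= (le_trans (ler_norm_sum _ _ _))//.
by apply: ler_sum => k _.
Qed.

Lemma dist1_ge0 (R : realType) (n : nat) (u v : 'rV[R]_n) : 0 <= dist1 u v.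
Proof. by apply: sumr_ge0. Qed.

Lemma dist1xx (R : realType) (n : nat) (u : 'rV[R]_n) : dist1 u u = 0.
Proof. by rewrite /dist1 big1// => i _; rewrite subrr normr0. Qed.

Lemma quadratic_le_expR (R : realType) (x : R) :
  0 <= x -> 1 + x + x ^+ 2 / 4 <= expR x.
Proof.
move=> x0; have -> : 1 + x + x ^+ 2 / 4 = (1 + x / 2) ^+ 2 by field.
have -> : expR x = expR (x / 2) ^+ 2.
  by rewrite expr2 -expRD -splitr.
by rewrite ler_sqr ?nnegrE ?expR_ge0 ?expR_ge1Dx// addr_ge0// divr_ge0.
Qed.

(** The left side is the jump-free part of a staggered step divided by [dt * P]: [A] stems from the
    sources, [L] from the nonlocal terms in the flux, and [kp] is the CFL number. For [kp <= 1 / 4]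
    the linear coefficients are at most [3 / 2] for [A] and [31 / 16] for [L], both below [2]. *)
Lemma cfl_remainder_le (R : realFieldType) (A L kp dt : R) :
  0 <= A -> 0 <= L -> 0 < dt -> kp <= 1 / 4 ->
  kp * A + kp * (3 / 4) * L + 3 / 2 * L + L * (dt * A / 2) + L * kp +
    (A + dt * A ^+ 2 / 2 + A * kp) <= 2 * (A + L) + dt * (A + L) ^+ 2.
Proof.
move=> A0 L0 dt0 kp4.
have h1 := ler_wpM2r A0 kp4; have h2 := ler_wpM2r L0 kp4.
have h3 : dt * (A * L / 2 + A ^+ 2 / 2) <= dt * (A + L) ^+ 2.
  have AL : 0 <= A * L by rewrite mulr_ge0.
  have := sqr_ge0 A; have := sqr_ge0 L.
  by rewrite ler_pM2l// sqrrD => ? ?; lra.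
lra.
Qed.

(** * Growth of the densities over one time step *)

Section one_step.
Context {R : realType} {m N : nat}.
Variables (F : 'I_N -> R -> 'rV[R]_m -> R)
          (Src : 'I_N -> 'rV[R]_N -> 'rV[R]_m -> R)
          (omega : 'I_m -> 'I_N -> R -> R) (V : 'I_m -> 'I_N -> R)
          (rhom rhoM LF LS dx dt : R) (N1 N2 : 'I_m -> 'I_N -> option nat).
Hypothesis omegaP : kernel_hyp omega.
Hypothesis omegaV : forall l k (a b : R), a <= b ->
  (total_variation a b (omega l k) <= (V l k)%:E)%E.
Hypotheses (rhom_ge0 : 0 <= rhom) (rhomM : rhom < rhoM).
Hypotheses (LF0 : 0 <= LF) (LS0 : 0 <= LS).
Hypothesis FP : flux_hyp F rhom rhoM LF.
Hypothesis SrcP : source_hyp Src rhom rhoM LS.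
Hypotheses (dx0 : 0 < dx) (dt0 : 0 < dt).
Hypothesis CFL : dt / dx * LF <= 1 / 4.

Variables (rho : int -> 'rV[R]_N) (P : R).
Hypothesis rho_range : step_in_range F Src omega dx dt N1 N2 rhom rhoM rho.
Hypothesis rhoP : forall j k, `|rho j 0 k| <= P.

(** For data bounded by [G], [dx * G * CW] bounds the [l^1] distance of neighbouring quadrature
    vectors; [A * P] bounds the sources and [q] bounds [rho_t]. *)
Let CW := \sum_l \sum_k 7 * (omega l k 0 + V l k).
Let A := LS * N%:R.
Let q := A * P + 2 * LF * P / dx.

Let P0 (k : 'I_N) : 0 <= P.
Proof. exact: le_trans (rhoP 0 k). Qed.

Let CW0 : 0 <= CW.
Proof.
apply: sumr_ge0 => l _; apply: sumr_ge0 => k _; have [_ _ w0 _ _] := omegaP l k.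
by rewrite mulr_ge0// addr_ge0//; exact: variation_bound_ge0 (@omegaV l k).
Qed.

Let A0 : 0 <= A.
Proof. by rewrite mulr_ge0. Qed.

Let nonlocal_quadB l k (G : R) (gl g gr : int -> R) (j : int) :
  (forall i, `|gl i| <= G) -> (forall i, `|g i| <= G) ->
  (forall i, `|gr i| <= G) ->
  `|nonlocal_quad dx (omega l k) (N1 l k) (N2 l k) gl g gr (j + 1) -
    nonlocal_quad dx (omega l k) (N1 l k) (N2 l k) gl g gr j|
  <= dx * (G * (7 * (omega l k 0 + V l k))).
Proof.
have [wint _ w0 _ _] := omegaP l k.
exact: (norm_nonlocal_quad_diff_le _ _ (@omegaV l k) w0 wint dx0).
Qed.

Let norm_slope_le k i : dx * `|slope dx rho k i| <= 2 * P.
Proof.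
have := norm_minmod_lel ((rho i 0 k - rho (i - 1) 0 k) / dx)
  ((rho (i + 1) 0 k - rho i 0 k) / dx).
rewrite normrM (@gtr0_norm _ dx^-1) ?invr_gt0// ler_pdivlMr// mulrC => H.
rewrite (le_trans H)// (le_trans (ler_normB _ _))//.
by have := rhoP i k; have := rhoP (i - 1) k; lra.
Qed.

Let nonlocal_compB l k j :
  `|nonlocal_comp omega dx N1 N2 rho l k (j + 1) -
    nonlocal_comp omega dx N1 N2 rho l k j|
  <= dx * (3 / 2 * P) * (7 * (omega l k 0 + V l k)).
Proof.
rewrite -[leRHS]mulrA; have := P0 k => P_ge0.
(* The reconstructed values in the boundary half cells deviate by at most [P / 2], whence the size
   [3 / 2 * P]. *)
have s4 i : `|dx / 4 * slope dx rho k i| <= P / 2.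
  have := norm_slope_le k i; rewrite normrM gtr0_norm ?divr_gt0//; lra.
apply: nonlocal_quadB => i.
- by rewrite (le_trans (ler_normD _ _))//; have := s4 i; have := rhoP i k; lra.
- by rewrite (le_trans (rhoP i k))//; lra.
- by rewrite (le_trans (ler_normB _ _))//; have := s4 i; have := rhoP i k; lra.
Qed.

Let dist1_nonlocal j :
  dist1 (nonlocal omega dx N1 N2 rho (j + 1)) (nonlocal omega dx N1 N2 rho j)
  <= dx * (3 / 2 * P) * CW.
Proof. by apply: dist1_row_sum_le => l k; exact: nonlocal_compB. Qed.

Let cube_rhom n : in_cube rhom rhoM (const_mx rhom : 'rV[R]_n).
Proof. by move=> i; rewrite mxE lexx ltW. Qed.

(* Both nonlinearities vanish at [rhom >= 0], hence are bounded by the size of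
   the density. *)
Let norm_flux_le k (r : R) w : rhom <= r <= rhoM -> in_cube rhom rhoM w ->
  `|F k r w| <= LF * r.
Proof.
move=> rr ww; have [Fm FL] := FP k; have /andP[r0 _] := rr.
have mm : rhom <= rhom <= rhoM by rewrite lexx ltW.
have := FL r rhom w w rr mm ww ww; rewrite Fm subr0 dist1xx addr0 => /le_trans.
by apply; rewrite ler_wpM2l// ger0_norm ?subr_ge0// gerBl.
Qed.

Let norm_source_le k (v : 'rV[R]_N) w (C : R) : in_cube rhom rhoM v ->
  in_cube rhom rhoM w -> (forall i, v 0 i <= C) -> `|Src k v w| <= A * C.
Proof.
move=> vv ww vC; have [Sm SL] := SrcP k.
have := SL v (const_mx rhom) w w vv (@cube_rhom N) ww ww.
rewrite Sm subr0 dist1xx addr0 => /le_trans; apply.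
(* Each of the [N] terms of the distance to the constant vector [rhom] is at most
   [C - rhom <= C]. *)
rewrite /A -mulrA ler_wpM2l// /dist1.
rewrite [leRHS]mulr_natl -[in leRHS](card_ord N) -sumr_const.
apply: ler_sum => i _.
have /andP[v1 _] := vv i; have := vC i.
by rewrite mxE ger0_norm ?subr_ge0//; apply: le_trans; rewrite gerBl.
Qed.

Let flux j k := F k (rho j 0 k) (nonlocal omega dx N1 N2 rho j).
Let Q k j := rho_t F Src omega dx N1 N2 rho k j.

Let norm_fluxP j k : `|flux j k| <= LF * P.
Proof.
have [r1 r2 _ _] := rho_range j.
rewrite (le_trans (norm_flux_le _ (r1 k) r2))// ler_wpM2l//.
by rewrite (le_trans (ler_norm _)).
Qed.

Let norm_fluxB j k : `|flux (j + 1) k - flux j k| <=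
  LF * (`|rho (j + 1) 0 k - rho j 0 k| + dx * (3 / 2 * P) * CW).
Proof.
have [r1 r2 _ _] := rho_range j; have [r3 r4 _ _] := rho_range (j + 1).
have [_ FL] := FP k.
rewrite (le_trans (FL _ _ _ _ (r3 k) (r1 k) r4 r2))//.
by rewrite ler_wpM2l// lerD2l.
Qed.

Let norm_source_rho j k :
  `|Src k (rho j) (nonlocal omega dx N1 N2 rho j)| <= A * P.
Proof.
have [r1 r2 _ _] := rho_range j; apply: norm_source_le => // i.
by rewrite (le_trans (ler_norm _)).
Qed.

(** The factor [1 / dx] in [q] is harmless: [q] always enters multiplied by [dt], and [dt / dx * LF]
    is bounded by the CFL condition. *)
Let norm_rho_t k j : `|Q k j| <= q.
Proof.
rewrite /Q /rho_t (le_trans (ler_normB _ _))// lerD//.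
rewrite (le_trans (norm_minmod_lel _ _))// normrM.
rewrite (@gtr0_norm _ dx^-1) ?invr_gt0// ler_pM2r ?invr_gt0//.
rewrite (le_trans (ler_normB _ _))//.
by have := norm_fluxP j k; have := norm_fluxP (j - 1) k; rewrite /flux; lra.
Qed.

(** The sources are bounded separately, but the flux slopes must be compared: consecutive ones share
    a difference quotient, so they bring in the jump of [rho], which the midpoint can absorb, rather
    than a multiple of [P / dx]. *)
Let norm_rho_tB k j : `|Q k (j + 1) - Q k j| <= 2 * (A * P) +
  LF * (`|rho (j + 1) 0 k - rho j 0 k| + dx * (3 / 2 * P) * CW) / dx.
Proof.
rewrite /Q /rho_t.
set S1 := Src _ _ _; set S0 := Src _ _ _; set s1 := flux_slope _ _ _ _ _ _ _ _.
set s0 := flux_slope _ _ _ _ _ _ _ _.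
have -> : S1 - s1 - (S0 - s0) = (S1 - S0) + (s0 - s1) by ring.
rewrite (le_trans (ler_normD _ _))// lerD//.
  rewrite (le_trans (ler_normB _ _))// mulr_natl mulr2n lerD//.
    exact: norm_source_rho.
  exact: norm_source_rho.
rewrite /s0 /s1 /flux_slope (addrK 1 j).
rewrite (le_trans (norm_minmodB_le _ _ _))// normrM.
rewrite (@gtr0_norm _ dx^-1) ?invr_gt0// ler_pM2r ?invr_gt0//.
exact: norm_fluxB.
Qed.

Let rhoh := rho_half F Src omega dx dt N1 N2 rho.
Let Rh := nonlocal_half F Src omega dx dt N1 N2 rho.

Let norm_rho_halfB k j : `|rhoh (j + 1) 0 k - rhoh j 0 k| <=
  `|rho (j + 1) 0 k - rho j 0 k| + dt / 2 * (2 * (A * P) +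
  LF * (`|rho (j + 1) 0 k - rho j 0 k| + dx * (3 / 2 * P) * CW) / dx).
Proof.
rewrite !mxE -/(Q k j) -/(Q k (j + 1)).
set r1 := rho (j + 1) 0 k; set r0 := rho j 0 k.
have -> : r1 + dt / 2 * Q k (j + 1) - (r0 + dt / 2 * Q k j) =
  (r1 - r0) + dt / 2 * (Q k (j + 1) - Q k j) by ring.
rewrite (le_trans (ler_normD _ _))// lerD2l normrM gtr0_norm ?divr_gt0//.
by rewrite ler_pM2l ?divr_gt0//; exact: norm_rho_tB.
Qed.

Let dist1_nonlocal_half j :
  dist1 (Rh (j + 1)) (Rh j) <= dx * (3 / 2 * P + dt / 2 * q) * CW.
Proof.
apply: dist1_row_sum_le => l k.
set c1 := nonlocal_comp _ _ _ _ _ _ _ _.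
set c0 := nonlocal_comp _ _ _ _ _ _ _ _.
set t1 := nonlocal_t_comp _ _ _ _ _ _ _ _ _ _.
set t0 := nonlocal_t_comp _ _ _ _ _ _ _ _ _ _.
have -> : c1 + dt / 2 * t1 - (c0 + dt / 2 * t0) =
  (c1 - c0) + dt / 2 * (t1 - t0) by ring.
set W := 7 * _.
have -> : dx * (3 / 2 * P + dt / 2 * q) * W =
  dx * (3 / 2 * P) * W + dt / 2 * (dx * (q * W)) by ring.
rewrite (le_trans (ler_normD _ _))// lerD//; first exact: nonlocal_compB.
rewrite normrM gtr0_norm ?divr_gt0// ler_pM2l ?divr_gt0//.
by apply: nonlocal_quadB => i; exact: norm_rho_t.
Qed.

Let norm_flux_halfB k j :
  `|F k (rhoh (j + 1) 0 k) (Rh (j + 1)) - F k (rhoh j 0 k) (Rh j)| <=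
  LF * (`|rho (j + 1) 0 k - rho j 0 k| + dt / 2 * (2 * (A * P) +
    LF * (`|rho (j + 1) 0 k - rho j 0 k| + dx * (3 / 2 * P) * CW) / dx) +
    dx * (3 / 2 * P + dt / 2 * q) * CW).
Proof.
have [_ _ r1 r2] := rho_range j; have [_ _ r3 r4] := rho_range (j + 1).
have [_ FL] := FP k.
rewrite (le_trans (FL _ _ _ _ (r3 k) (r1 k) r4 r2))//.
by rewrite ler_wpM2l// lerD.
Qed.

Let norm_source_half k j : `|Src k (rhoh j) (Rh j)| <= A * (P + dt / 2 * q).
Proof.
have [_ _ r1 r2] := rho_range j; apply: norm_source_le => // i.
rewrite mxE lerD//; first by rewrite (le_trans (ler_norm _)).
by rewrite ler_pM2l ?divr_gt0// (le_trans (ler_norm _))//; exact: norm_rho_t.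
Qed.

Let C := 2 * (LS * N%:R + LF * CW).

Let C_ge0 : 0 <= C.
Proof. by rewrite mulr_ge0// addr_ge0// mulr_ge0. Qed.

Let norm_staggered_le k j :
  `|staggered F Src omega dx dt N1 N2 rho j 0 k| <= P * expR (C * dt).
Proof.
rewrite mxE -/rhoh -/Rh.
set s0 := slope _ _ _ _; set s1 := slope _ _ _ _.
set F1 := F k _ _; set F0 := F k _ _; set S1 := Src k _ _; set S0 := Src k _ _.
pose D := `|rho (j + 1) 0 k - rho j 0 k|.
have P_ge0 := P0 k.
have D0 : 0 <= D by exact: normr_ge0.
have hs : dx / 8 * `|s0 - s1| <= D / 8.
  have : `|s0 - s1| <= D / dx.
    rewrite /s0 /s1 /slope addrK (le_trans (norm_minmodB_le _ _ _))//.
    by rewrite normrM (@gtr0_norm _ dx^-1) ?invr_gt0.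
  by rewrite ler_pdivlMr// mulrC; lra.
have hF := norm_flux_halfB k j; rewrite -/F1 -/F0 -/D in hF.
have hS1 : `|S1| <= A * (P + dt / 2 * q) := norm_source_half k (j + 1).
have hS0 : `|S0| <= A * (P + dt / 2 * q) := norm_source_half k j.
pose kp := dt / dx * LF; pose L := LF * CW.
have L0 : 0 <= L by rewrite mulr_ge0.
have kp0 : 0 <= kp by rewrite !mulr_ge0 ?invr_ge0// ltW.
have kp4 : kp <= 1 / 4 by [].
pose c := dt * P * (2 * (A + L)) + dt ^+ 2 * P * (A + L) ^+ 2.
(* The jump [D] is separated from a remainder proportional to [dt * P]; the factor [1 + kp / 2]
   comes from the jump of the half-step densities. *)
have hF' : dt / dx * `|F1 - F0| <= kp * (1 + kp / 2) * D +
   dt * P * (kp * A + kp * (3 / 4) * L + 3 / 2 * L + L * (dt * A / 2) + L * kp).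
  have -> : kp * (1 + kp / 2) * D +
      dt * P * (kp * A + kp * (3 / 4) * L + 3 / 2 * L + L * (dt * A / 2) +
        L * kp) =
    dt / dx * (LF * (D + dt / 2 * (2 * (A * P) +
    LF * (D + dx * (3 / 2 * P) * CW) / dx) +
    dx * (3 / 2 * P + dt / 2 * q) * CW)).
    by rewrite /q /kp /L; field; rewrite gt_eqF.
  by rewrite ler_pM2l// divr_gt0.
have hS : dt / 2 * `|S1 + S0| <= dt * P * (A + dt * A ^+ 2 / 2 + A * kp).
  have -> : dt * P * (A + dt * A ^+ 2 / 2 + A * kp) =
      dt / 2 * (A * (P + dt / 2 * q) + A * (P + dt / 2 * q)).
    by rewrite /q /kp; field; rewrite gt_eqF.
  by rewrite ler_pM2l ?divr_gt0// (le_trans (ler_normD _ _))// lerD.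
apply: (@le_trans _ _ (P + c)).
  rewrite -!addrA; apply: norm_midpoint_le => //; rewrite -/D.
  apply: (@le_trans _ _ (dx / 8 * `|s0 - s1| + dt / dx * `|F1 - F0| +
      dt / 2 * `|S1 + S0|)).
    rewrite (le_trans (ler_normD _ _))// -addrA lerD//.
      by rewrite normrM gtr0_norm// divr_gt0.
    rewrite (le_trans (ler_normD _ _))// normrN.
    rewrite [X in X + _]normrM [X in _ + X]normrM.
    by rewrite (@gtr0_norm _ (dt / 2)) ?(@gtr0_norm _ (dt / dx)) ?divr_gt0.
  (* The slopes take [1 / 8] and the fluxes at most [1 / 4 * 9 / 8 = 9 / 32]; the total [13 / 32] is
     below [1 / 2]. *)
  have hD : D / 8 + kp * (1 + kp / 2) * D <= D / 2.
    have kk : kp * (1 + kp / 2) <= 1 / 4 * (1 + 1 / 4 / 2).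
      by rewrite ler_pM//; lra.
    by have := ler_wpM2r D0 kk; lra.
  have dtP : 0 <= dt * P by rewrite mulr_ge0// ltW.
  have hc : dt * P * (kp * A + kp * (3 / 4) * L + 3 / 2 * L + L * (dt * A / 2) +
      L * kp) + dt * P * (A + dt * A ^+ 2 / 2 + A * kp) <= c.
    have -> : c = dt * P * (2 * (A + L) + dt * (A + L) ^+ 2).
      by rewrite /c; ring.
    rewrite -mulrDr ler_wpM2l//.
    exact: cfl_remainder_le.
  lra.
have -> : P + c = P * (1 + C * dt + (C * dt) ^+ 2 / 4).
  by rewrite /c /C -/A -/L; field.
by rewrite ler_wpM2l// quadratic_le_expR// mulr_ge0// ltW.
Qed.

Lemma norm_nt_step_le k j :
  `|nt_step F Src omega dx dt N1 N2 rho j 0 k| <= P * expR (C * dt).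
Proof.
(* The remainder is [0]: the slope term is at most [D / 8], so returning to the original grid causes
   no further growth. *)
rewrite mxE -[leRHS]addr0.
apply: norm_midpoint_le; [exact: norm_staggered_le..|].
set D := `|_ - _|; have D0 : 0 <= D by exact: normr_ge0.
rewrite normrN normrM gtr0_norm ?divr_gt0// addr0.
have : `|staggered_slope F Src omega dx dt N1 N2 rho k j -
    staggered_slope F Src omega dx dt N1 N2 rho k (j - 1)| <= D / dx.
  rewrite /staggered_slope subrK (le_trans (norm_minmodB_le _ _ _))//.
  by rewrite normrM (@gtr0_norm _ dx^-1) ?invr_gt0.
by rewrite ler_pdivlMr// mulrC; lra.
Qed.

End one_step.

(** * The index [nstar], signs of the constants, and induction in time *)

Lemma first_failure_exists (P : nat -> Prop) :
  exists nstar, first_failure P nstar.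
Proof.
have [allP|/existsNP[n0 nP]] := pselect (forall n, P n); first by exists None.
have ex : exists n, `[< ~ P n >] by exists n0; apply/asboolP.
exists (Some (ex_minn ex)) => /=; case: ex_minnP => n /asboolP nPn min.
split=> // i; rewrite ltnNge => /negP iltn; apply: contrapT => nPi.
by apply/iltn/min/asboolP.
Qed.

(** Reaching index [n.+1] takes a step from [n], which lies strictly before the first failure; hence
    the estimate still holds at [nstar] itself. *)
Lemma first_failure_lt (P : nat -> Prop) (nstar : option nat) (n : nat) :
  first_failure P nstar -> up_to n.+1 nstar -> P n.
Proof.
by case: nstar => [n0 [Plt _]|allP _] /=; [exact: Plt | exact: allP].
Qed.

(** The Lipschitz bound is tested between the distinct points [rhoM] and [rhom]. *)
Lemma flux_constant_ge0 (R : realType) (m N : nat)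
    (F : 'I_N -> R -> 'rV[R]_m -> R) (rhom rhoM LF : R) :
  'I_N -> rhom < rhoM -> flux_hyp F rhom rhoM LF -> 0 <= LF.
Proof.
move=> k rhomM FP; have [_ FL] := FP k.
have cube : in_cube rhom rhoM (const_mx rhom : 'rV[R]_m).
  by move=> i; rewrite mxE lexx ltW.
have hM : rhom <= rhoM <= rhoM by rewrite lexx ltW.
have hm : rhom <= rhom <= rhoM by rewrite lexx ltW.
have := le_trans (normr_ge0 _) (FL _ _ _ _ hM hm cube cube).
rewrite dist1xx addr0.
by rewrite pmulr_lge0// normr_gt0 subr_eq0 gt_eqF.
Qed.

Lemma source_hyp_norm (R : realType) (m N : nat)
    (Src : 'I_N -> 'rV[R]_N -> 'rV[R]_m -> R) (rhom rhoM LS : R) :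
  source_hyp Src rhom rhoM LS -> source_hyp Src rhom rhoM `|LS|.
Proof.
move=> SP k; have [S0 SL] := SP k; split=> // v v' w w' hv hv' hw hw'.
rewrite (le_trans (SL _ _ _ _ hv hv' hw hw'))// ler_wpM2r ?ler_norm//.
by rewrite addr_ge0// dist1_ge0.
Qed.

Lemma cfl_constant_le (R : realType) : (Num.sqrt 2 - 1) / 2 <= 1 / 4 :> R.
Proof.
have : Num.sqrt 2 <= 3 / 2 :> R.
  by rewrite -ler_sqr ?nnegrE ?sqrtr_ge0// sqr_sqrtr//; lra.
lra.
Qed.

Theorem theorem2p13 (R : realType) (N m : nat) (N_gt0 : (0 < N)%N)
    (m_gt0 : (0 < m)%N)
    (F : 'I_N -> R -> 'rV[R]_m -> R)
    (Src : 'I_N -> 'rV[R]_N -> 'rV[R]_m -> R)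
    (omega : 'I_m -> 'I_N -> R -> R) (rhoM LF LS : R)
    (omegaP : kernel_hyp omega) :
  exists C4 : R, 0 <= C4 /\
  forall (rhom : R) (rho0 : 'I_N -> R -> R),
    0 <= rhom -> rhom < rhoM ->
    flux_hyp F rhom rhoM LF ->
    source_hyp Src rhom rhoM LS ->
    initial_hyp rho0 rhom rhoM ->
  forall (dx dt : R) (N1 N2 : 'I_m -> 'I_N -> option nat),
    0 < dx -> 0 < dt ->
    (forall l k, support_cells dx (omega l k) (N1 l k) (N2 l k)) ->
    dt / dx * LF <= (Num.sqrt 2 - 1) / 2 ->
  let rho := nt_solution F Src omega dx dt N1 N2 rho0 in
  exists nstar : option nat,
    first_failure
      (fun n => step_in_range F Src omega dx dt N1 N2 rhom rhoM (rho n))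
      nstar /\
    forall (n : nat) (j : int) (k : 'I_N), up_to n nstar ->
      (`|rho n j 0 k|%:E <= max_Linfty rho0 * (expR (C4 * (n%:R * dt)))%:E)%E.
Proof.
have [V omegaV] : exists V : 'I_m -> 'I_N -> R, forall l k (a b : R), a <= b ->
    (total_variation a b (omega l k) <= (V l k)%:E)%E.
  have VP l k : {V | forall a b : R, a <= b ->
      (total_variation a b (omega l k) <= V%:E)%E}.
    by apply: cid; have [_ ? _ _ _] := omegaP l k.
  by exists (fun l k => sval (VP l k)) => l k; exact: svalP (VP l k).
pose CW := \sum_l \sum_k 7 * (omega l k 0 + V l k).
(* The constant is chosen before [flux_hyp] is assumed, so the sign of [LF] is not yet known; the
   outer absolute value ensures nonnegativity. *)
exists (`|2 * (`|LS| * N%:R + LF * CW)|); split=> // rhom rho0.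
move=> rhom_ge0 rhomM FP SP rho0P dx dt N1 N2 dx0 dt0 _ CFL rho.
have LF0 : 0 <= LF by exact: flux_constant_ge0 (Ordinal N_gt0) rhomM FP.
have [nstar nstarP] := first_failure_exists (fun n =>
  step_in_range F Src omega dx dt N1 N2 rhom rhoM (rho n)).
exists nstar; split=> // n j k n_le; set C4 := (X in expR (X * _)).
rewrite -[max_Linfty rho0]fineK ?(max_Linfty_fin_num rhom_ge0 rhomM rho0P)//.
rewrite -EFinM lee_fin; set K := fine _.
elim: n j k n_le => [|n IH] j k n_le.
  rewrite !mul0r mulr0 expR0 mulr1.
  exact: (norm_cell_average_le rhom_ge0 rhomM rho0P).
have n_le' : up_to n nstar by move: n_le; case: (nstar) => //= n0; exact: ltnW.
have -> : C4 * (n.+1%:R * dt) = C4 * (n%:R * dt) + C4 * dt.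
  by rewrite -[n.+1]addn1 natrD; ring.
rewrite expRD mulrA.
(* The step estimate is used with [P = K * expR (C4 * (n%:R * dt))]; its rate, the expression under
   the outer absolute value, is then enlarged to [C4]. *)
apply: le_trans (norm_nt_step_le omegaP omegaV rhom_ge0 rhomM LF0 (normr_ge0 LS)
  FP (source_hyp_norm SP) dx0 dt0 (le_trans CFL (cfl_constant_le R))
  (first_failure_lt nstarP n_le) (fun j k => IH j k n_le') k j) _.
rewrite ler_wpM2l//; first exact: le_trans (IH j k n_le').
by rewrite ler_expR ler_wpM2r ?ler_norm// ltW.
Qed.
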